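(* Let $\mathfrak{g}$ be a real nilpotent Lie algebra of dimension $n$, graded over a torsion-free abelian group $A$, i.e. $\mathfrak{g}=\bigoplus_{\alpha\in A}\mathfrak{g}_\alpha$ with $[\mathfrak{g}_\alpha,\mathfrak{g}_\beta]\subset\mathfrak{g}_{\alpha+\beta}$. Suppose there is a weight sequence $w_1,\dots,w_n$ (a sequence in which each weight $\alpha$ appears exactly $\dim\mathfrak{g}_\alpha$ times) satisfying, with $\hat i=n+1-i$: (G1) if $w_i+w_j=w_k$ and $i\neq j$, then $i,j<k$; (G2) if $w_i+w_{\hat i}=w_j$, then $j=n$; (G3) if $w_i+w_{\hat i}=w_n$ and $w_i\neq w_{\hat i}$, then one of $w_i,w_{\hat i}$ has multiplicity at least two; (G4) if $w_i+w_{\hat i}=w_n$ and $w_i=w_{\hat i}$, then either $i=\hat i$ or $w_i$ has multiplicity greater than two; (G5) if $w_i+w_j$ is a weight and $w_{\hat i}+w_{\hat j}$ is a weight, then $w_j=w_{\hat i}$ and $w_i=w_{\hat j}$. Then $\mathfrak{g}$ has a Ricci-flat metric of the form $\sum_{i=1}^n e^i\otimes e^{\hat i}$, where $e_1,\dots,e_n$ is a basis of $\mathfrak{g}$ with $e_i\in\mathfrak{g}_{w_i}$ and $e^1,\dots,e^n$ is the dual basis.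
   Context: A weight of the grading is an $\alpha\in A$ with $\mathfrak{g}_\alpha\neq0$, and its multiplicity is $\dim\mathfrak{g}_\alpha$. A metric on $\mathfrak{g}$ is a nondegenerate symmetric bilinear form of arbitrary signature; its Ricci tensor is that of the associated left-invariant pseudo-Riemannian metric on a connected Lie group with Lie algebra $\mathfrak{g}$, restricted to $\mathfrak{g}$; Ricci-flat means the Ricci tensor vanishes. *)

(* Defs.v *)
From mathcomp Require Import all_boot all_order all_algebra.
From mathcomp Require Import reals.
Set Implicit Arguments. Unset Strict Implicit. Unset Printing Implicit Defensive.
Import Order.TTheory GRing.Theory Num.Theory.
Local Open Scope ring_scope.

(* The Lie algebra g of dimension n is identified (via a choice of linear
   coordinates) with the row space 'rV[R]_n, R the real numbers. *)

Section LieDefs.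
Variable R : realType.
Variable n : nat.
Notation V := 'rV[R]_n.

Definition is_lie_bracket (br : V -> V -> V) : Prop :=
  [/\ forall (a : R) x y z, br (a *: x + y) z = a *: br x z + br y z,
      forall (a : R) x y z, br z (a *: x + y) = a *: br z x + br z y,
      forall x, br x x = 0
    & forall x y z, br x (br y z) + br y (br z x) + br z (br x y) = 0].

(* nilpotent: the lower central series vanishes, i.e. all iterated brackets
   [x_1,[x_2,[...,[x_k,x]...]]] of some fixed length k vanish *)
Definition lie_nilpotent (br : V -> V -> V) : Prop :=
  exists k : nat, forall (xs : seq V) (x : V), size xs = k -> foldr br x xs = 0.

(* metrics: the symmetric bilinear bform (x,y) |-> x G y^T with G symmetric
   and invertible (nondegenerate, arbitrary signature) *)
Definition bform (G : 'M[R]_n) (x y : V) : R := (x *m G *m y^T) 0 0.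
Definition is_metric (G : 'M[R]_n) : Prop := G^T = G /\ G \in unitmx.

(* Levi-Civita connection of the left-invariant metric, on left-invariant
   vector fields (Koszul formula):
   2 <nabla_X Y, Z> = <[X,Y],Z> - <[Y,Z],X> + <[Z,X],Y> *)
Definition koszul (br : V -> V -> V) (G : 'M[R]_n) (X Y Z : V) : R :=
  (bform G (br X Y) Z - bform G (br Y Z) X + bform G (br Z X) Y) / 2%:R.
Definition nabla (br : V -> V -> V) (G : 'M[R]_n) (X Y : V) : V :=
  (\row_k koszul br G X Y (delta_mx 0 k)) *m invmx G.
Definition curv (br : V -> V -> V) (G : 'M[R]_n) (X Y Z : V) : V :=
  nabla br G X (nabla br G Y Z) - nabla br G Y (nabla br G X Z)
  - nabla br G (br X Y) Z.
Definition ricci (br : V -> V -> V) (G : 'M[R]_n) (Y Z : V) : R :=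
  \sum_(k < n) (curv br G (delta_mx 0 k) Y Z) 0 k.
Definition ricci_flat (br : V -> V -> V) (G : 'M[R]_n) : Prop :=
  forall Y Z : V, ricci br G Y Z = 0.

(* gradings over an abelian group A: gr a is (the row space of) g_a *)
Definition is_grading (A : zmodType) (br : V -> V -> V) (gr : A -> 'M[R]_n)
  : Prop :=
  (exists s : seq A,
     [/\ uniq s, forall a, a \notin s -> \rank (gr a) = 0%N,
         mxdirect (\sum_(a <- s) gr a) & (\sum_(a <- s) gr a == (1%:M : 'M[R]_n))%MS])
  /\ forall a b (x y : V), (x <= gr a)%MS -> (y <= gr b)%MS ->
       (br x y <= gr (a + b)%R)%MS.

Definition mult (A : zmodType) (gr : A -> 'M[R]_n) (a : A) : nat := \rank (gr a).
Definition is_weight (A : zmodType) (gr : A -> 'M[R]_n) (a : A) : bool :=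
  (0 < \rank (gr a))%N.

Definition weight_seq (A : zmodType) (gr : A -> 'M[R]_n) (w : 'I_n -> A) : Prop :=
  forall a : A, #|[set i | w i == a]| = mult gr a.

End LieDefs.

Definition torsion_free (A : zmodType) : Prop :=
  forall (a : A) (k : nat), a *+ k.+1 = 0 -> a = 0.

(* Main.v *)
(* In coordinates for which the metric is antidiagonal, (G1) kills the terms of
   the Ricci tensor involving two adjoint maps and makes the algebra unimodular,
   so that 4 Ric(e_i, e_j) is the sum over k, l of
   <[e_k, e_l], e_j> <[e_k^, e_l^], e_i>, where ^ is the index reversal.  By (G5)
   and (G2) this vanishes unless i = j = 1, where it is the squared norm of the
   2-form B(x, y) = n-th coordinate of [x, y].  It remains to choose the adapted
   basis so that B is null.  If e_i can be paired with e_i^, the multiplicities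
   granted by (G3) and (G4) allow to arrange B(e_i, e_i^) = 0 for all i; then the
   norm averages to zero over sign changes of the basis, hence can be made
   nonnegative, and a transvection moves it along a concave quadratic, which
   has a real root. *)
Require Import Defs.
From mathcomp Require Import all_boot all_order all_algebra.
From mathcomp Require Import reals.
From mathcomp Require Import perm ring lra zify.
Import Order.TTheory GRing.Theory Num.Theory.
Local Open Scope ring_scope.
Set Implicit Arguments. Unset Strict Implicit. Unset Printing Implicit Defensive.

(** * Making a homogeneous skew form null by a degree-preserving change of basis *)

Section NullForm.
Variables (R : rcfType) (n : nat) (A : zmodType) (w : 'I_n -> A) (om : A).
Implicit Types (B P Q : 'M[R]_n) (i j k l a b : 'I_n) (t : R).

Definition graded_mx P := forall i j, P i j != 0 -> w i = w j.

(** The inverse carries its own gradedness, so the inverse of a matrix that is block diagonal along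
    the weights need not be analysed again. *)
Definition graded_unit P :=
  exists Q, [/\ P *m Q = 1%:M, graded_mx P & graded_mx Q].

Definition homogeneous_mx B := forall i j, B i j != 0 -> w i + w j = om.

Definition skew_mx B := forall i j, B i j = - B j i.

(** Full contraction of [B] with itself in the antidiagonal metric, where raising an index means
    reversing it. *)
Definition hat_norm B := \sum_i \sum_j B i j * B (rev_ord i) (rev_ord j).

Lemma skew_mx_diag B i : skew_mx B -> B i i = 0.
Proof. by move=> /(_ i i) e; lra. Qed.

Lemma mulmx_neq0 m p q (X : 'M[R]_(m, p)) (Y : 'M_(p, q)) (i : 'I_m) (j : 'I_q) :
  (X *m Y) i j != 0 -> exists2 k : 'I_p, X i k != 0 & Y k j != 0.
Proof.
move=> nz; have [k /andP[? ?]|none] := pickP (fun k : 'I_p => (X i k != 0) && (Y k j != 0)).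
  by exists k.
case/eqP: nz; rewrite mxE big1 // => k _; move: (none k) => /negbT.
by rewrite negb_and !negbK => /orP[]/eqP->; rewrite ?mul0r ?mulr0.
Qed.

Lemma graded_mxM P Q : graded_mx P -> graded_mx Q -> graded_mx (P *m Q).
Proof. by move=> gP gQ i j /mulmx_neq0[k /gP-> /gQ]. Qed.

Lemma graded_mx1 : graded_mx 1%:M.
Proof. by move=> i j; rewrite mxE; case: (eqVneq i j) => [->|]; rewrite ?eqxx. Qed.

Lemma graded_unit1 : graded_unit 1%:M.
Proof. by exists 1%:M; rewrite mulmx1; split=> //; apply: graded_mx1. Qed.

Lemma graded_unitM P1 P2 :
  graded_unit P1 -> graded_unit P2 -> graded_unit (P1 *m P2).
Proof.
move=> [Q1 [e1 g1 h1]] [Q2 [e2 g2 h2]]; exists (Q2 *m Q1).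
split; [|exact: graded_mxM|exact: graded_mxM].
by rewrite mulmxA -(mulmxA P1) e2 mulmx1.
Qed.

Lemma homogeneous_congr P B :
  graded_mx P -> homogeneous_mx B -> homogeneous_mx (P *m B *m P^T).
Proof.
move=> gP hB i j /mulmx_neq0[l /mulmx_neq0[k /gP-> /hB <-]].
by rewrite mxE => /gP->.
Qed.

Lemma skew_mxP B : skew_mx B <-> B^T = - B.
Proof.
split=> [s|e i j]; first by apply/matrixP=> i j; rewrite !mxE s.
by move/matrixP: e => /(_ j i); rewrite !mxE.
Qed.

Lemma skew_congr P B : skew_mx B -> skew_mx (P *m B *m P^T).
Proof.
by move=> /skew_mxP e; apply/skew_mxP; rewrite !trmx_mul trmxK e mulmxA mulmxN mulNmx.
Qed.

Definition transvection i k t : 'M[R]_n := 1%:M + t *: delta_mx i k.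

Lemma transvection_unit i k t :
  i != k -> w k = w i -> graded_unit (transvection i k t).
Proof.
move=> ik wk; have g s : graded_mx (transvection i k s).
  move=> a b; rewrite !mxE.
  case: (eqVneq a b) => [->//|_]; rewrite add0r.
  case: (eqVneq a i) => [->|_] /=; last by rewrite mulr0 eqxx.
  by case: (eqVneq b k) => [->|_] /=; rewrite ?mulr0 ?eqxx.
exists (transvection i k (- t)); split=> //.
rewrite /transvection mulmxDl mul1mx mulmxDr mulmx1 -scalemxAl -scalemxAr.
by rewrite mul_delta_mx_0 1?eq_sym // !scaler0 addr0 scaleNr addrNK.
Qed.

Lemma delta_mulE i k B a b :
  (delta_mx i k *m B) a b = (a == i)%:R * B k b.
Proof.
rewrite mxE (bigD1 k) //= big1 => [|l /negPf lk]; rewrite mxE ?lk ?andbF ?mul0r //.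
by rewrite eqxx andbT addr0.
Qed.

(** The term in [t ^+ 2] sits at [(i, i)] with coefficient [B k k], so the congruence is affine in
    [t]. *)
Lemma transvection_congrE i k t B a b : B k k = 0 ->
  (transvection i k t *m B *m (transvection i k t)^T) a b =
  B a b + t * ((a == i)%:R * B k b + (b == i)%:R * B a k).
Proof.
move=> kk; rewrite /transvection mulmxDl mul1mx linearD /= trmx1 mulmxDr mulmx1.
rewrite linearZ /= trmx_delta.
have e X : (X *m (t *: delta_mx k i)) a b = t * (b == i)%:R * X a k.
  rewrite -scalemxAr mxE -[X *m _]trmxK trmx_mul trmx_delta mxE delta_mulE mxE.
  by rewrite mulrA.
have e' b' (X Y : 'M[R]_n) : (X + t *: Y) a b' = X a b' + t * Y a b' by rewrite !mxE.
by rewrite mxE e -scalemxAl !e' !delta_mulE kk; ring.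
Qed.

(** A suitable multiple of the vector [k] added to the vector [i] kills the entry [(i, rev_ord i)].
    Only row and column [i] change, so the only antidiagonal entries affected are those at [i] and
    [rev_ord i], both nonzero beforehand. *)
Lemma clear_hat_diag_transvection B i k : skew_mx B -> k != i -> w k = w i ->
    B i (rev_ord i) != 0 -> B k (rev_ord i) != 0 ->
  exists2 P, graded_unit P &
    [set a | (P *m B *m P^T) a (rev_ord a) != 0]
      \proper [set a | B a (rev_ord a) != 0].
Proof.
move=> sB ki wk nzi nzk.
have ii : rev_ord i != i.
  by apply: contraNneq nzi => ->; rewrite skew_mx_diag.
exists (transvection i k (- (B i (rev_ord i) / B k (rev_ord i)))).
  by apply: transvection_unit; rewrite // eq_sym.
apply/properP; split; last first.
  exists i; rewrite inE // negbK transvection_congrE ?skew_mx_diag //.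
  rewrite eqxx (negPf ii) mul1r mul0r addr0; apply/eqP; field; exact: nzk.
apply/subsetP=> a; rewrite !inE transvection_congrE ?skew_mx_diag //.
have [->|ai] := eqVneq a i; first by [].
have [ria|ria] := eqVneq (rev_ord a) i; last by rewrite !mul0r addr0 mulr0 addr0.
by rewrite -ria rev_ordK [B a _]sB oppr_eq0 in nzi *.
Qed.

(** The exchange puts [B k (rev_ord i)] and [B i (rev_ord k)] on the antidiagonal, or the diagonal
    entry [B i i] in place of the latter when [k] is its own reversal. All of these vanish. *)
Lemma clear_hat_diag_swap B i k : skew_mx B -> k != i -> k != rev_ord i -> w k = w i ->
    B i (rev_ord i) != 0 -> B k (rev_ord i) = 0 -> B i (rev_ord k) = 0 ->
  exists2 P, graded_unit P &
    [set a | (P *m B *m P^T) a (rev_ord a) != 0]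
      \proper [set a | B a (rev_ord a) != 0].
Proof.
move=> sB ki kri wk nzi z1 z2.
have ii : rev_ord i != i.
  by apply: contraNneq nzi => ->; rewrite skew_mx_diag.
have g : graded_mx (tperm_mx i k).
  move=> a b; rewrite !mxE; case: tpermP => [->|->|_ _].
  - by case: (eqVneq _ b) => [<-|]; rewrite ?eqxx ?wk.
  - by case: (eqVneq _ b) => [<-|]; rewrite ?eqxx ?wk.
  - by case: (eqVneq _ b) => [<-|]; rewrite ?eqxx.
have E a b : (tperm_mx i k *m B *m (tperm_mx i k)^T) a b =
             B (tperm i k a) (tperm i k b).
  by rewrite tr_tperm_mx -xrowE -xcolE !mxE.
exists (tperm_mx i k).
  exists (tperm_mx i k); split=> //.
  by rewrite /tperm_mx -perm_mxM tperm2 perm_mx1.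
have zk a : a = i \/ a = k -> B (tperm i k a) (tperm i k (rev_ord a)) = 0.
  move=> [->|->]; first by rewrite tpermL tpermD // eq_sym.
  rewrite tpermR; have [->|rk] := eqVneq (rev_ord k) k.
    by rewrite tpermR skew_mx_diag.
  rewrite tpermD //; last by rewrite eq_sym.
  by apply: contraNneq kri => ->; rewrite rev_ordK.
apply/properP; split; last by exists i; rewrite inE // negbK E zk //; left.
apply/subsetP=> a; rewrite !inE E.
have [ai|nai] := eqVneq a i; first by rewrite zk ?eqxx //; left.
have [ak|nak] := eqVneq a k; first by rewrite zk ?eqxx //; right.
have [rai|nrai] := eqVneq (rev_ord a) i.
  by rewrite sB -[X in _ _ (_ X)]rev_ordK zk ?oppr0 ?eqxx //; left.
have [rak|nrak] := eqVneq (rev_ord a) k.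
  by rewrite sB -[X in _ _ (_ X)]rev_ordK zk ?oppr0 ?eqxx //; right.
by rewrite !tpermD // eq_sym.
Qed.

(** The common form in which (G3) and (G4) enter the construction. *)
Definition spare_index := forall i, i != rev_ord i -> w i + w (rev_ord i) = om ->
  exists k, [/\ k != i, k != rev_ord i & w k = w i \/ w k = w (rev_ord i)].

(** Induction on the number of nonzero antidiagonal entries: a spare index always allows a change of
    basis that strictly decreases it. *)
Lemma zero_hat_diag B : skew_mx B -> homogeneous_mx B -> spare_index ->
  exists2 P, graded_unit P & forall i, (P *m B *m P^T) i (rev_ord i) = 0.
Proof.
move=> sB hB hp.
have [m] := ubnP #|[set a | B a (rev_ord a) != 0]|.
elim: m => // m IH in B sB hB *; rewrite ltnS => le_m.
have [i nzi|none] := pickP (fun i => B i (rev_ord i) != 0); last first.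
  exists 1%:M; first exact: graded_unit1.
  by move=> i; rewrite mul1mx trmx1 mulmx1; apply/eqP/negbFE/none.
suff [P1 gP1 /proper_card ltP1] : exists2 P, graded_unit P &
    [set a | (P *m B *m P^T) a (rev_ord a) != 0]
      \proper [set a | B a (rev_ord a) != 0].
  have [Q [_ gr1 _]] := gP1.
  have [|||P2 gP2 z] := IH (P1 *m B *m P1^T).
  - exact: skew_congr.
  - exact: homogeneous_congr.
  - exact: leq_trans le_m.
  exists (P2 *m P1); first exact: graded_unitM.
  by move=> j; rewrite -(z j) trmx_mul !mulmxA.
have ii : i != rev_ord i.
  by apply: contraNneq nzi => <-; rewrite skew_mx_diag.
have [k [ki kri]] := hp i ii (hB _ _ nzi).
(* By skewness the entries at [i] and [rev_ord i] are opposite, so these two indices can exchange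
   roles. *)
wlog wk : i nzi ii ki kri / w k = w i.
  move=> H [wk|wk]; first by apply: (H i) => //; left.
  apply: (H (rev_ord i)); rewrite ?rev_ordK //; last by left.
  - by rewrite sB oppr_eq0.
  - by rewrite eq_sym.
move=> _.
(* Pair k with i through B k (rev_ord i), else rev_ord k with rev_ord i through
   B i (rev_ord k); if both vanish, exchanging i and k clears the entry at i. *)
have [z1|nz1] := eqVneq (B k (rev_ord i)) 0; last exact: (@clear_hat_diag_transvection B i k).
have [z2|nz2] := eqVneq (B i (rev_ord k)) 0; first exact: (@clear_hat_diag_swap B i k).
apply: (@clear_hat_diag_transvection B (rev_ord i) (rev_ord k)) => //.
- by rewrite (inj_eq rev_ord_inj).
- by apply: (addrI (w i)); rewrite (hB _ _ nz2) (hB _ _ nzi).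
- by rewrite rev_ordK sB oppr_eq0.
- by rewrite rev_ordK sB oppr_eq0.
Qed.

Definition sign_mx (d : {ffun 'I_n -> bool}) : 'M[R]_n :=
  diag_mx (\row_i (-1) ^+ d i).

Lemma sign_congrE d B i j :
  (sign_mx d *m B *m (sign_mx d)^T) i j = (-1) ^+ d i * (-1) ^+ d j * B i j.
Proof.
rewrite tr_diag_mx mul_mx_diag mul_diag_mx !mxE; ring.
Qed.

Lemma sign_mx_unit d : graded_unit (sign_mx d).
Proof.
have g : graded_mx (sign_mx d).
  by move=> i j; rewrite !mxE; case: (eqVneq i j) => [->|] //; rewrite mulr0n eqxx.
exists (sign_mx d); split=> //; apply/matrixP=> i j.
rewrite mul_diag_mx !mxE; case: eqVneq => [->|]; last by rewrite mulr0.
by rewrite !mulr1n -signr_addb addbb.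
Qed.

(** Flipping the sign at [x] is an involution on sign choices that negates every term. *)
Lemma sum_signs (i j k l x : 'I_n) :
    ((i == x) + (j == x) + (k == x) + (l == x) = 1)%N ->
  \sum_(d : {ffun 'I_n -> bool})
     (-1) ^+ d i * (-1) ^+ d j * ((-1) ^+ d k * (-1) ^+ d l) = 0 :> R.
Proof.
move=> e; set S := \sum_d _.
pose flip (d : {ffun 'I_n -> bool}) := [ffun a => d a (+) (a == x)].
have fK : involutive flip by move=> d; apply/ffunP=> a; rewrite !ffunE addbK.
suff: S = - S by move=> ?; lra.
rewrite {1}/S (reindex_inj (inv_inj fK)) -sumrN /=; apply: eq_bigr => d _.
have H (p q r s p' q' r' s' : R) : p' * q' * r' * s' = -1 ->
    p * p' * (q * q') * (r * r' * (s * s')) = - (p * q * (r * s)).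
  by move=> h; rewrite -[RHS]mulN1r -h; ring.
by rewrite !ffunE !signr_addb H // -!exprD e.
Qed.

(* When the entries B i (rev_ord i) vanish, every remaining term of the norm
   has an index occurring once, so the norm averages to 0 over all signs. *)
Lemma sign_hat_norm_ge0 B : skew_mx B -> (forall i, B i (rev_ord i) = 0) ->
  exists d, 0 <= hat_norm (sign_mx d *m B *m (sign_mx d)^T).
Proof.
move=> sB z.
have s0 : \sum_d hat_norm (sign_mx d *m B *m (sign_mx d)^T) = 0.
  rewrite /hat_norm exchange_big big1 //= => i _.
  rewrite exchange_big big1 //= => j _.
  under eq_bigr => d _ do rewrite !sign_congrE mulrACA.
  rewrite -mulr_suml.
  have [->|nij] := eqVneq i j; first by rewrite skew_mx_diag // mul0r mulr0.
  have [->|nrij] := eqVneq j (rev_ord i); first by rewrite z mul0r mulr0.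
  have rji : rev_ord j != i by apply: contraNneq nrij => <-; rewrite rev_ordK.
  (* The index occurring once is [i], unless [i] is the middle index; then it is [j], since there is
     only one middle index. *)
  have [ri|nri] := eqVneq (rev_ord i) i; last first.
    rewrite (@sum_signs _ _ _ _ i) ?mul0r // eqxx (negPf nri) (negPf rji).
    by rewrite eq_sym (negPf nij).
  rewrite (@sum_signs _ _ _ _ j) ?mul0r // eqxx ri (negPf nij).
  case: eqVneq => // rj; case/eqP: nij; apply: val_inj.
  by move/(congr1 val): rj; move/(congr1 val): ri => /=; lia.
have [d|none] := pickP (fun d => 0 <= hat_norm (sign_mx d *m B *m (sign_mx d)^T)).
  by exists d.
(* If all norms were negative, their zero sum would force each of them to be zero, so any choice of
   signs closes this case. *)
exists [ffun=> false].
suff /(_ [ffun=> false] isT)/eqP :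
    forall d, true -> - hat_norm (sign_mx d *m B *m (sign_mx d)^T) = 0.
  by rewrite oppr_eq0 => /eqP->.
apply: psumr_eq0P => [d _|]; last by rewrite sumrN s0 oppr0.
by move: (none d) => /negbT; rewrite -ltNge oppr_ge0 => /ltW.
Qed.

(** The signs of [c] and [q] make the discriminant nonnegative, so its square root exists in a real
    closed field. *)
Lemma concave_quadratic_root (c l q : R) : 0 <= c -> q < 0 ->
  exists t, c + t * l + t ^+ 2 * q = 0.
Proof.
move=> c0 q0; pose s := Num.sqrt (l ^+ 2 - 4 * c * q).
have s2 : s ^+ 2 = l ^+ 2 - 4 * c * q by rewrite sqr_sqrtr //; nra.
exists ((- l - s) / (2 * q)).
transitivity ((s ^+ 2 - (l ^+ 2 - 4 * c * q)) / (4 * q)); last first.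
  by rewrite s2 subrr mul0r.
by field; rewrite lt_eqF.
Qed.

Hypothesis hats_swap : forall i j, w i + w j = om ->
  w (rev_ord i) + w (rev_ord j) = om -> w j = w (rev_ord i) /\ w i = w (rev_ord j).

(* Some term B i j * B (rev_ord i) (rev_ord j) is nonzero; adding t times the
   vector of index [rev_ord j] to the one of index i turns the norm into a
   quadratic in t whose leading coefficient is -2 (B (rev_ord j) (rev_ord i))^2. *)
Lemma zero_hat_norm_transvection B : skew_mx B -> homogeneous_mx B ->
    (forall i, B i (rev_ord i) = 0) -> 0 <= hat_norm B ->
  exists2 P, graded_unit P & hat_norm (P *m B *m P^T) = 0.
Proof.
move=> sB hB z ge0.
have [F0|nF0] := eqVneq (hat_norm B) 0.
  by exists 1%:M; [exact: graded_unit1|rewrite mul1mx trmx1 mulmx1].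
have [i [j [nri nz nz']]] : exists i j,
    [/\ i != rev_ord i, B i j != 0 & B (rev_ord i) (rev_ord j) != 0].
  have [[i j] /= nz|none] := pickP (fun x : 'I_n * 'I_n =>
      B x.1 x.2 * B (rev_ord x.1) (rev_ord x.2) != 0); last first.
    case/eqP: nF0; rewrite /hat_norm big1 // => i _; rewrite big1 // => j _.
    by apply/eqP/negbFE; exact: (none (i, j)).
  move: nz; rewrite mulf_eq0 negb_or => /andP[nz nz'].
  (* When [i] is the middle index, [i] and [j] are exchanged; both being the middle index would make
     the entry diagonal. *)
  have [ri|] := eqVneq i (rev_ord i); last by exists i, j.
  exists j, i; split; rewrite 1?sB ?oppr_eq0 //.
  apply: contraNneq nz => rj; suff -> : i = j by rewrite skew_mx_diag.
  apply: val_inj; move/(congr1 val): rj; move/(congr1 val): ri => /=.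
  by have := ltn_ord i; have := ltn_ord j; lia.
pose k := rev_ord j.
have nzk : B k (rev_ord i) != 0 by rewrite sB oppr_eq0.
have ki : i != k.
  by apply: contraNneq nz => e; rewrite -[j]rev_ordK -/k -e z.
have wk : w k = w i by have [_ ->] := hats_swap (hB _ _ nz) (hB _ _ nz').
pose U a b := (a == i)%:R * B k b + (b == i)%:R * B a k.
pose L := \sum_a \sum_b
  (B a b * U (rev_ord a) (rev_ord b) + U a b * B (rev_ord a) (rev_ord b)).
pose Q := \sum_a \sum_b U a b * U (rev_ord a) (rev_ord b).
have FE t : hat_norm (transvection i k t *m B *m (transvection i k t)^T) =
    hat_norm B + t * L + t ^+ 2 * Q.
  rewrite /hat_norm /L /Q !mulr_sumr -!big_split; apply: eq_bigr => a _ /=.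
  rewrite !mulr_sumr -!big_split; apply: eq_bigr => b _ /=.
  by rewrite !transvection_congrE ?skew_mx_diag // -!/(U _ _); ring.
have sU a b : U a b = - U b a by rewrite /U (sB k) (sB a); ring.
(* [U] is supported on row and column [i]. As [i] is not the middle index, both factors can be
   nonzero only for [b = rev_ord a], where skewness makes the product minus a square. *)
have Ule a b : U a b * U (rev_ord a) (rev_ord b) <= 0.
  have [->|nb] := eqVneq b (rev_ord a).
    by rewrite rev_ordK [U (rev_ord a) a]sU mulrN oppr_le0 -expr2 sqr_ge0.
  have nrb : rev_ord b != a by apply: contraNneq nb => <-; rewrite rev_ordK.
  have [ai|nai] := eqVneq a i.
    rewrite {}ai in nb nrb *.
    by rewrite [X in _ * X]/U [_ i == i]eq_sym (negPf nri) (negPf nrb) !mul0r addr0 mulr0.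
  have [bi|nbi] := eqVneq b i.
    rewrite {}bi in nb nrb *.
    rewrite [X in _ * X]/U [_ i == i]eq_sym (negPf nri) [_ a == i]eq_sym (negPf nb).
    by rewrite !mul0r addr0 mulr0.
  by rewrite [X in X * _]/U (negPf nai) (negPf nbi) !mul0r addr0 mul0r.
have Q0 : Q < 0.
  rewrite /Q (bigD1 i) //= (bigD1 (rev_ord i)) //=.
  have le0 (p : pred 'I_n) (F : 'I_n -> R) : (forall a, F a <= 0) ->
      \sum_(a | p a) F a <= 0.
    by move=> F0; elim/big_ind: _ => // x y x0 y0; lra.
  apply: ltr_wnDr; first by apply: (le0) => a; apply: (le0) => b.
  apply: ltr_wnDr; first by apply: (le0) => b.
  rewrite rev_ordK [U (rev_ord i) i]sU mulrN oppr_lt0 -expr2 exprn_even_gt0 //=.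
  by rewrite /U eqxx [_ == i]eq_sym (negPf nri) mul0r addr0 mul1r.
have [t e] := concave_quadratic_root L ge0 Q0.
exists (transvection i k t); first exact: transvection_unit.
by rewrite FE.
Qed.

Lemma zero_hat_norm B : skew_mx B -> homogeneous_mx B -> spare_index ->
  exists2 P, graded_unit P & hat_norm (P *m B *m P^T) = 0.
Proof.
move=> sB hB hp.
have [P1 gu1 z1] := zero_hat_diag sB hB hp.
have [_ [_ g1 _]] := gu1.
have [d ge0] := sign_hat_norm_ge0 (skew_congr P1 sB) z1.
have gu2 := sign_mx_unit d; have [_ [_ g2 _]] := gu2.
case: (@zero_hat_norm_transvection
    (sign_mx d *m (P1 *m B *m P1^T) *m (sign_mx d)^T)) => //.
- by do 2!apply: skew_congr.
- by do 2!apply: homogeneous_congr => //.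
- by move=> i; rewrite sign_congrE z1 mulr0.
move=> P3 gu3 z3; exists (P3 *m (sign_mx d *m P1)).
  by do 2!apply: graded_unitM => //.
by rewrite -[RHS]z3 !trmx_mul !mulmxA.
Qed.

End NullForm.

(** * Multilinearity of the curvature tensors and their behaviour under change of basis *)

Section Bform.
Variables (R : realType) (n : nat).
Local Notation V := 'rV[R]_n.
Implicit Types (G E : 'M[R]_n) (a : R) (x y z : V).

Lemma linear_coord_sum (W : lmodType R) (f : V -> W) (x : V) :
  (forall a y z, f (a *: y + z) = a *: f y + f z) ->
  f x = \sum_k x 0 k *: f (delta_mx 0 k).
Proof.
move=> lf.
have f0 : f 0 = 0.
  by have := lf (-1) 0 0; rewrite scaler0 addr0 scaleN1r addNr.
have fZ a y : f (a *: y) = a *: f y by rewrite -[a *: y]addr0 lf f0 addr0.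
have fD y z : f (y + z) = f y + f z by rewrite -[y]scale1r lf !scale1r.
rewrite {1}(row_sum_delta x) (big_morph f fD f0).
by apply: eq_bigr => k _; rewrite fZ.
Qed.

Lemma bformDl G a x y z : bform G (a *: x + y) z = a * bform G x z + bform G y z.
Proof. by rewrite /bform !mulmxDl -!scalemxAl !mxE. Qed.

Lemma bformDr G a x y z : bform G z (a *: x + y) = a * bform G z x + bform G z y.
Proof. by rewrite /bform linearP mulmxDr -scalemxAr !mxE. Qed.

Section Bracket.
Variables (br : V -> V -> V).
Hypothesis brDl : forall a x y z, br (a *: x + y) z = a *: br x z + br y z.
Hypothesis brDr : forall a x y z, br z (a *: x + y) = a *: br z x + br z y.

Lemma koszulD1 G a x y z u :
  koszul br G (a *: x + y) z u = a * koszul br G x z u + koszul br G y z u.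
Proof. by rewrite /koszul brDl brDr !bformDl bformDr; ring. Qed.

Lemma koszulD2 G a x y z u :
  koszul br G z (a *: x + y) u = a * koszul br G z x u + koszul br G z y u.
Proof. by rewrite /koszul brDl brDr !bformDl bformDr; ring. Qed.

Lemma koszulD3 G a x y z u :
  koszul br G z u (a *: x + y) = a * koszul br G z u x + koszul br G z u y.
Proof. by rewrite /koszul brDl brDr !bformDl bformDr; ring. Qed.

Lemma nablaD1 G a x y z :
  nabla br G (a *: x + y) z = a *: nabla br G x z + nabla br G y z.
Proof.
rewrite /nabla scalemxAl -mulmxDl; congr (_ *m _).
by apply/rowP=> k; rewrite !mxE koszulD1.
Qed.

Lemma nablaD2 G a x y z :
  nabla br G z (a *: x + y) = a *: nabla br G z x + nabla br G z y.
Proof.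
rewrite /nabla scalemxAl -mulmxDl; congr (_ *m _).
by apply/rowP=> k; rewrite !mxE koszulD2.
Qed.

Lemma curvD1 G a x y z u :
  curv br G (a *: x + y) z u = a *: curv br G x z u + curv br G y z u.
Proof.
rewrite /curv brDl !nablaD1 nablaD2 !scalerBr.
by apply/rowP=> k; rewrite !mxE; ring.
Qed.

Lemma curvD2 G a x y z u :
  curv br G z (a *: x + y) u = a *: curv br G z x u + curv br G z y u.
Proof.
rewrite /curv brDr !nablaD1 nablaD2 !scalerBr.
by apply/rowP=> k; rewrite !mxE; ring.
Qed.

Lemma curvD3 G a x y z u :
  curv br G z u (a *: x + y) = a *: curv br G z u x + curv br G z u y.
Proof.
rewrite /curv !nablaD2 !scalerBr.
by apply/rowP=> k; rewrite !mxE; ring.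
Qed.

Lemma ricciD1 G a x y z :
  ricci br G (a *: x + y) z = a *: (ricci br G x z : R^o) + ricci br G y z.
Proof.
rewrite /ricci scaler_sumr -big_split /=; apply: eq_bigr => k _.
by rewrite curvD2 !mxE.
Qed.

Lemma ricciD2 G a x y z :
  ricci br G z (a *: x + y) = a *: (ricci br G z x : R^o) + ricci br G z y.
Proof.
rewrite /ricci scaler_sumr -big_split /=; apply: eq_bigr => k _.
by rewrite curvD3 !mxE.
Qed.

Lemma ricci_flat_basis G :
  (forall k l, ricci br G (delta_mx 0 k) (delta_mx 0 l) = 0) -> ricci_flat br G.
Proof.
move=> z0 y z.
rewrite (@linear_coord_sum R^o (fun y => ricci br G y z)); last first.
  by move=> a ? ?; exact: ricciD1.
rewrite big1 // => k _.
rewrite (@linear_coord_sum R^o (fun z => ricci br G _ z)); last first.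
  by move=> a ? ?; exact: ricciD2.
by rewrite big1 ?scaler0 // => l _; rewrite z0 scaler0.
Qed.

Lemma koszul_sum G x y z :
  koszul br G x y z = \sum_k z 0 k * koszul br G x y (delta_mx 0 k).
Proof.
rewrite (@linear_coord_sum R^o (koszul br G x y)) //.
by move=> a ? ?; exact: koszulD3.
Qed.

Lemma bform_nabla G x y z : G \in unitmx ->
  bform G (nabla br G x y) z = koszul br G x y z.
Proof.
move=> uG; rewrite koszul_sum /bform /nabla mulmxKV // mxE.
by apply: eq_bigr => k _; rewrite !mxE mulrC.
Qed.

(** Nondegeneracy lets the Koszul formula determine the connection; this is what compares [nabla] in
    two bases. *)
Lemma nabla_unique G x y v : G \in unitmx ->
  (forall z, bform G v z = koszul br G x y z) -> nabla br G x y = v.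
Proof.
move=> uG e; apply: (canLR (mulmxK uG)); apply/rowP=> k.
by rewrite mxE -e /bform trmx_delta -colE mxE.
Qed.

End Bracket.

(** The bracket read in the basis formed by the rows of [E]: [x *m E] is the vector with coordinates
    [x]. *)
Definition transport (br : V -> V -> V) E x y := br (x *m E) (y *m E) *m invmx E.

Section Transport.
Variables (br : V -> V -> V) (E G : 'M[R]_n).
Hypothesis brDl : forall a x y z, br (a *: x + y) z = a *: br x z + br y z.
Hypothesis brDr : forall a x y z, br z (a *: x + y) = a *: br z x + br z y.
Hypothesis uE : E \in unitmx.
Hypothesis uG : G \in unitmx.
Local Notation br' := (transport br E).
Local Notation G' := (invmx E *m G *m (invmx E)^T).

Lemma transportDl a x y z : br' (a *: x + y) z = a *: br' x z + br' y z.
Proof. by rewrite /transport mulmxDl -scalemxAl brDl mulmxDl -scalemxAl. Qed.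

Lemma transportDr a x y z : br' z (a *: x + y) = a *: br' z x + br' z y.
Proof. by rewrite /transport mulmxDl -scalemxAl brDr mulmxDl -scalemxAl. Qed.

Lemma transportE x y : br (x *m E) (y *m E) = br' x y *m E.
Proof. by rewrite /transport mulmxKV. Qed.

Lemma bform_transport x y : bform G' (x *m E) (y *m E) = bform G x y.
Proof.
rewrite /bform !mulmxA mulmxK // -!mulmxA -trmx_mul mulmxK //.
Qed.

Lemma koszul_transport x y z :
  koszul br G' (x *m E) (y *m E) (z *m E) = koszul br' G x y z.
Proof. by rewrite /koszul !transportE !bform_transport. Qed.

Lemma transport_metric_unit : G' \in unitmx.
Proof. by rewrite !unitmx_mul unitmx_tr unitmx_inv uE uG. Qed.

Lemma nabla_transport x y :
  nabla br G' (x *m E) (y *m E) = nabla br' G x y *m E.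
Proof.
apply: nabla_unique; first exact: transport_metric_unit.
move=> z; rewrite -[z](mulmxKV uE) bform_transport koszul_transport.
apply: bform_nabla => //; [exact: transportDl|exact: transportDr].
Qed.

Lemma curv_transport x y z :
  curv br G' (x *m E) (y *m E) (z *m E) = curv br' G x y z *m E.
Proof. by rewrite /curv transportE !nabla_transport !mulmxBl. Qed.

(* The trace of an endomorphism does not depend on the basis. *)
Lemma ricci_transport y z : ricci br G' (y *m E) (z *m E) = ricci br' G y z.
Proof.
pose M := \matrix_(k, l) curv br' G (delta_mx 0 k) y z 0 l.
have cM x : curv br' G x y z = x *m M.
  rewrite (@linear_coord_sum _ (fun x => curv br' G x y z)); last first.
    by move=> a ? ?; apply: curvD1; [exact: transportDl|exact: transportDr].
  apply/rowP=> l; rewrite summxE mxE.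
  by apply: eq_bigr => k _; rewrite !mxE.
transitivity (\tr (invmx E *m M *m E)); last first.
  rewrite mxtrace_mulC mulmxA mulmxV // mul1mx.
  by apply: eq_bigr => k _; rewrite mxE.
apply: eq_bigr => k _.
rewrite -[delta_mx 0 k](mulmxKV uE) curv_transport cM.
by rewrite -!mulmxA -rowE mxE !mulmxA.
Qed.

(** Reduces the curvature computation to the case where the chosen basis is the standard one. *)
Lemma ricci_flat_transport : ricci_flat br' G -> ricci_flat br G'.
Proof.
move=> flat y z; rewrite -[y](mulmxKV uE) -[z](mulmxKV uE) ricci_transport.
exact: flat.
Qed.

End Transport.
End Bform.

(** * The Ricci tensor of the antidiagonal metric for a triangular bracket *)

Section HatMetric.
Variables (R : realType) (n : nat).
Local Notation V := 'rV[R]_n.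
Local Notation "''e_' k" := (delta_mx 0 k : V) (at level 8, k at level 2).

Definition hat_mx : 'M[R]_n := \matrix_(i, j) (j == rev_ord i)%:R.

Lemma hat_mx_sym : hat_mx^T = hat_mx.
Proof.
apply/matrixP=> i j; rewrite !mxE; congr (_%:R).
by rewrite -(inj_eq rev_ord_inj) rev_ordK eq_sym.
Qed.

Lemma bform_hat (x y : V) : bform hat_mx x y = \sum_k x 0 k * y 0 (rev_ord k).
Proof.
rewrite /bform -mulmxA mxE; apply: eq_bigr => k _; congr (_ * _).
rewrite mxE (bigD1 (rev_ord k)) //= big1 => [|l nl].
  by rewrite !mxE eqxx mul1r addr0.
by rewrite !mxE (negPf nl) mul0r.
Qed.

Lemma bform_hatr (x : V) k : bform hat_mx x 'e_k = x 0 (rev_ord k).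
Proof.
rewrite bform_hat (bigD1 (rev_ord k)) //= big1 => [|l nl].
  by rewrite rev_ordK !mxE !eqxx mulr1 addr0.
rewrite mxE eqxx -(inj_eq rev_ord_inj) rev_ordK (negPf nl) mulr0 //.
Qed.

Lemma hat_mx_unit : hat_mx \in unitmx.
Proof.
suff /mulmx1_unit[] : hat_mx *m hat_mx = 1%:M by [].
apply/matrixP=> i j; rewrite mxE (bigD1 (rev_ord i)) //= big1 => [|k nk].
  by rewrite !mxE eqxx rev_ordK mul1r addr0 eq_sym.
by rewrite !mxE (negPf nk) mul0r.
Qed.

Variable br : V -> V -> V.
Hypothesis brDl : forall a x y z, br (a *: x + y) z = a *: br x z + br y z.
Hypothesis brDr : forall a x y z, br z (a *: x + y) = a *: br z x + br z y.
Hypothesis brxx : forall x, br x x = 0.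
(** What (G1) gives for the structure constants of an adapted basis. *)
Hypothesis br_triangular : forall i j k, i != j -> br 'e_i 'e_j 0 k != 0 ->
  (i < k)%N /\ (j < k)%N.

(* C i j k = <[e_i, e_j], e_k> and N i j k = <nabla_(e_i) e_j, e_k>. *)
Let C i j k : R := br 'e_i 'e_j 0 (rev_ord k).

Let N i j k : R := (C i j k - C j k i + C k i j) / 2.

Lemma bracket_skew (x y : V) : br x y = - br y x.
Proof.
have bD u v z : br (u + v) z = br u z + br v z by have := brDl 1 u v z; rewrite !scale1r.
have bDr u v z : br z (u + v) = br z u + br z v by have := brDr 1 u v z; rewrite !scale1r.
have := brxx (x + y); rewrite bD !bDr !brxx add0r addr0 => /eqP.
by rewrite addr_eq0 => /eqP.
Qed.

Let C_skew i j k : C i j k = - C j i k.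
Proof. by rewrite /C bracket_skew mxE. Qed.

Let C_lt i j k : C i j k != 0 -> (i < rev_ord k)%N /\ (j < rev_ord k)%N.
Proof.
have [->|ij] := eqVneq i j; first by rewrite /C brxx mxE eqxx.
exact: br_triangular.
Qed.

Let nablaE i j k : nabla br hat_mx 'e_i 'e_j 0 k = N i j (rev_ord k).
Proof.
rewrite -[k in LHS]rev_ordK -bform_hatr bform_nabla //; last exact: hat_mx_unit.
by rewrite /koszul !bform_hatr.
Qed.

Let nabla_row i (y : V) k :
  nabla br hat_mx 'e_i y 0 k = \sum_l y 0 l * N i l (rev_ord k).
Proof.
rewrite (@linear_coord_sum _ _ _ (nabla br hat_mx 'e_i) y); last first.
  by move=> a ? ?; exact: nablaD2.
by rewrite summxE; apply: eq_bigr => l _; rewrite mxE nablaE.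
Qed.

Let nabla_rowl (x : V) j k :
  nabla br hat_mx x 'e_j 0 k = \sum_l x 0 l * N l j (rev_ord k).
Proof.
rewrite (@linear_coord_sum _ _ _ (fun x => nabla br hat_mx x 'e_j) x); last first.
  by move=> a ? ?; exact: nablaD1.
by rewrite summxE; apply: eq_bigr => l _; rewrite mxE nablaE.
Qed.

Lemma sum2_rev (F : 'I_n -> 'I_n -> R) :
  \sum_k \sum_l F k l = \sum_k \sum_l F (rev_ord k) (rev_ord l).
Proof.
rewrite (reindex_inj rev_ord_inj); apply: eq_bigr => k _ /=.
by rewrite (reindex_inj rev_ord_inj).
Qed.

Lemma sum2_skew (F : 'I_n -> 'I_n -> R) :
  (forall k l, F k l = - F l k) -> \sum_k \sum_l F k l = 0.
Proof.
move=> sF; set S := LHS; suff: S = - S by move=> ?; lra.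
rewrite {1}/S exchange_big -sumrN; apply: eq_bigr => k _ /=.
by rewrite -sumrN; apply: eq_bigr => l _.
Qed.

Let C_diag i k : C i k (rev_ord k) = 0.
Proof. by apply/eqP; apply: contraT => /C_lt[_]; rewrite rev_ordK ltnn. Qed.

(** This is the divergence of [e_l]. Two of the three Koszul terms are diagonal entries of the
    adjoint map of [e_l], and the third is odd under reversal of [k]. *)
Let unimodular l : \sum_k N k l (rev_ord k) = 0.
Proof.
rewrite /N -mulr_suml.
under eq_bigr => k _.
  rewrite [C k l _]C_skew C_diag oppr0 sub0r -[X in C l _ X]rev_ordK.
  rewrite C_diag oppr0 add0r.
  over.
rewrite /= (_ : \sum_k _ = 0) ?mul0r //.
set S := LHS; suff: S = - S by move=> ?; lra.
rewrite {1}/S (reindex_inj rev_ord_inj) -sumrN; apply: eq_bigr => k _ /=.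
by rewrite rev_ordK C_skew.
Qed.

(** A term of the metric pairing of the adjoint maps of [e_i] and [e_j]. A nonzero first factor
    forces [k + l < n - 1], a nonzero second one [k + l > n - 1]. *)
Let CC_par i j k l : C i k l * C j (rev_ord k) (rev_ord l) = 0.
Proof.
apply/eqP; apply: contraT; rewrite mulf_eq0 negb_or => /andP[/C_lt[_ h1] /C_lt[_]].
by move: h1; have := ltn_ord k; have := ltn_ord l; rewrite /=; lia.
Qed.

(** A term of the Killing form, excluded by the same two inequalities. *)
Let CC_cross i j k l : C i k l * C j (rev_ord l) (rev_ord k) = 0.
Proof.
apply/eqP; apply: contraT; rewrite mulf_eq0 negb_or => /andP[/C_lt[_ h1] /C_lt[_]].
by move: h1; have := ltn_ord k; have := ltn_ord l; rewrite /=; lia.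
Qed.

Lemma ricci_hatE i j : ricci br hat_mx 'e_i 'e_j =
  (\sum_k \sum_l br 'e_k 'e_l 0 (rev_ord j) *
     br 'e_(rev_ord k) 'e_(rev_ord l) 0 (rev_ord i)) / 4.
Proof.
(* [T] collects the last two terms of the curvature; the trace of the first one vanishes by
   [unimodular]. *)
pose T k l := - N k j l * N i (rev_ord l) (rev_ord k)
              - C k i l * N (rev_ord l) j (rev_ord k).
have -> : ricci br hat_mx 'e_i 'e_j = \sum_k \sum_l T k l.
  have subE (x y z : V) k : (x - y - z) 0 k = x 0 k - y 0 k - z 0 k.
    by rewrite !mxE.
  rewrite /ricci /curv.
  under eq_bigr => k _.
    rewrite subE (nabla_row k (nabla br hat_mx 'e_i 'e_j)).
    rewrite (nabla_row i (nabla br hat_mx 'e_k 'e_j)) (nabla_rowl (br 'e_k 'e_i)).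
    under eq_bigr => l _ do rewrite nablaE.
    over.
  rewrite !big_split /= [X in X + _ + _]exchange_big /= big1 ?add0r; last first.
    by move=> l _; rewrite -mulr_sumr unimodular mulr0.
  rewrite -big_split; apply: eq_bigr => k _ /=.
  rewrite -opprD -big_split -sumrN (reindex_inj rev_ord_inj).
  apply: eq_bigr => l _ /=; rewrite nablaE rev_ordK /T /C; ring.
(* These are the unwanted products that survive [CC_par] and [CC_cross]. [Y] is a symmetric factor
   times a skew one; [Z] sums to minus [X] and [W] to [X], so [Z - W + 2 X] cancels in the total. *)
pose X k l := C i k l * C (rev_ord k) (rev_ord l) j.
pose Y k l := (C j k l + C j l k) * C (rev_ord k) (rev_ord l) i.
pose Z k l := C k l j * C i (rev_ord l) (rev_ord k).
pose W k l := C k l j * C i (rev_ord k) (rev_ord l).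
have Y0 : \sum_k \sum_l Y k l = 0.
  by apply: sum2_skew => k l; rewrite /Y [C (rev_ord k) _ _]C_skew; ring.
have WX : \sum_k \sum_l W k l = \sum_k \sum_l X k l.
  rewrite sum2_rev; apply: eq_bigr => k _; apply: eq_bigr => l _.
  by rewrite /W /X !rev_ordK mulrC.
have ZX : \sum_k \sum_l Z k l = - \sum_k \sum_l X k l.
  rewrite -WX exchange_big -sumrN; apply: eq_bigr => k _; rewrite -sumrN.
  by apply: eq_bigr => l _; rewrite /W /Z [C l _ _]C_skew mulNr.
have TE k l : 4 * T k l = C k l j * C (rev_ord k) (rev_ord l) i
                          + Y k l + Z k l - W k l + 2 * X k l.
  have p1 := CC_par j i k l; have p2 := CC_cross j i k l.
  have p3 := CC_par j i l k; have p4 := CC_cross j i l k.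
  have p5 := CC_par i j k l; have p6 := CC_cross i j k l.
  rewrite /T /N /X /Y /Z /W (C_skew k i) (C_skew l k) (C_skew k j).
  rewrite (C_skew (rev_ord l) (rev_ord k)) (C_skew (rev_ord k) i).
  rewrite (C_skew (rev_ord l) j).
  move: p1 p2 p3 p4 p5 p6.
  generalize (C j k l) (C j l k) (C k l j) (C i (rev_ord l) (rev_ord k))
    (C i (rev_ord k) (rev_ord l)) (C (rev_ord k) (rev_ord l) i) (C i k l)
    (C j (rev_ord l) (rev_ord k)) (C j (rev_ord k) (rev_ord l))
    (C (rev_ord k) (rev_ord l) j).
  by move=> *; lra.
apply: (canRL (mulfK _)); first by rewrite pnatr_eq0.
rewrite mulrC mulr_sumr.
under eq_bigr => k _.
  rewrite mulr_sumr; under eq_bigr => l _ do rewrite TE.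
  rewrite !(big_split, sumrN) -mulr_sumr /=; over.
rewrite !(big_split, sumrN) /= -mulr_sumr Y0 WX ZX /C.
ring.
Qed.
End HatMetric.

(** * A basis compatible with the grading and the weight sequence *)

Section AdaptedBasis.
Variables (R : realType) (n : nat) (A : zmodType).
Variables (gr : A -> 'M[R]_n) (w : 'I_n -> A).

(** The indices of weight [a] are as many as the dimension of [gr a], so they can enumerate a basis
    of it. *)
Lemma adapted_basis (s : seq A) :
    weight_seq gr w -> (\sum_(a <- s) gr a == (1%:M : 'M[R]_n))%MS ->
  exists E : 'M[R]_n,
    [/\ E \in unitmx, forall i, (row i E <= gr (w i))%MS
      & forall a (x : 'rV_n), (x <= gr a)%MS ->
          forall k, (x *m invmx E) 0 k != 0 -> w k = a].
Proof.
move=> ws /andP[_ full].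
pose I a := [set i | w i == a].
pose rows a := [seq row k (row_base (gr a)) | k : 'I_(\rank (gr a))].
pose E := \matrix_i nth 0 (rows (w i)) (index i (enum (I (w i)))).
(* [D a] projects onto the coordinates of weight [a]. The inclusion [grE] yields both the
   invertibility of [E] and the support of the coordinates of vectors in [gr a]. *)
pose D a : 'M[R]_n := diag_mx (\row_i (w i == a)%:R).
have grE a : (gr a <= D a *m E)%MS.
  rewrite -(eq_row_base (gr a)); apply/row_subP=> k.
  have [i wi ik] : exists2 i, w i = a & index i (enum (I a)) = k.
    pose k' := cast_ord (esym (ws a)) k.
    exists (enum_val k').
      by have := enum_valP k'; rewrite inE => /eqP.
    have i0 := enum_val k'.
    by rewrite (enum_val_nth i0) index_uniq ?enum_uniq // -cardE.
  suff -> : row k (row_base (gr a)) = row i (D a *m E) by exact: row_sub.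
  rewrite row_mul row_diag_mx mxE wi eqxx scale1r -rowE rowK wi ik.
  rewrite (nth_map k) ?size_enum_ord // nth_ord_enum //.
have uE : E \in unitmx.
  rewrite -row_full_unit -sub1mx (submx_trans full) //.
  elim/big_ind: _ => [|X Y X1 Y1|a _]; first exact: sub0mx.
    by rewrite addsmx_sub X1.
  exact: submx_trans (grE a) (submxMl _ _).
exists E; split=> // [i|a x xa k].
  rewrite rowK; set r := index _ _.
  have [lt|ge] := ltnP r (size (rows (w i))); last by rewrite nth_default ?sub0mx.
  have /mapP[k _ ->] := mem_nth 0 lt.
  by rewrite (submx_trans (row_sub _ _)) ?eq_row_base.
have /submxP[z ->] := submx_trans xa (grE a).
rewrite mulmxA mulmxK // mul_mx_diag !mxE.
by case: (w k =P a) => // _; rewrite mulr0 eqxx.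
Qed.
End AdaptedBasis.

(** * Structure constants as bilinear forms *)

Section Structure.
Variables (R : realType) (n : nat) (br : 'rV[R]_n -> 'rV[R]_n -> 'rV[R]_n).
Hypothesis brDl : forall a x y z, br (a *: x + y) z = a *: br x z + br y z.
Hypothesis brDr : forall a x y z, br z (a *: x + y) = a *: br z x + br z y.

(** With the output coordinate fixed, a change of basis in the arguments acts by congruence. *)
Definition structure_mx k : 'M[R]_n :=
  \matrix_(i, j) br (delta_mx 0 i) (delta_mx 0 j) 0 k.

Lemma bracket_coord (x y : 'rV_n) k :
  br x y 0 k = (x *m structure_mx k *m y^T) 0 0.
Proof.
rewrite (@linear_coord_sum _ _ _ (fun x => br x y) x); last by move=> a ? ?; exact: brDl.
rewrite -mulmxA mxE summxE; apply: eq_bigr => i _.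
rewrite [LHS]mxE; congr (_ * _); rewrite mxE.
rewrite (@linear_coord_sum _ _ _ (br (delta_mx 0 i)) y); last by move=> a ? ?; exact: brDr.
by rewrite summxE; apply: eq_bigr => j _; rewrite [LHS]mxE !mxE mulrC.
Qed.

Lemma bracket_coord_rows (P : 'M[R]_n) i j k :
  br (row i P) (row j P) 0 k = (P *m structure_mx k *m P^T) i j.
Proof.
by rewrite bracket_coord tr_row colE mulmxA -colE -!row_mul mxE mxE.
Qed.

End Structure.

(* indices are shifted: the paper's i in 1..n is our i : 'I_n (0..n-1),
   and hat i = n+1-i becomes rev_ord i = n-1-i; w_n is w at index n.-1 *)
Theorem theorem1p3 (R : realType) (n : nat) (A : zmodType)
    (br : 'rV[R]_n -> 'rV[R]_n -> 'rV[R]_n) (gr : A -> 'M[R]_n)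
    (w : 'I_n -> A) :
  is_lie_bracket br -> lie_nilpotent br ->
  torsion_free A -> is_grading br gr ->
  weight_seq gr w ->
  (* (G1) *)
  (forall i j k : 'I_n, w i + w j = w k -> i != j -> (i < k)%N /\ (j < k)%N) ->
  (* (G2) *)
  (forall i j : 'I_n, w i + w (rev_ord i) = w j -> (j : nat) = n.-1) ->
  (* (G3) *)
  (forall i m : 'I_n, (m : nat) = n.-1 -> w i + w (rev_ord i) = w m ->
     w i != w (rev_ord i) ->
     (2 <= mult gr (w i))%N \/ (2 <= mult gr (w (rev_ord i)))%N) ->
  (* (G4) *)
  (forall i m : 'I_n, (m : nat) = n.-1 -> w i + w (rev_ord i) = w m ->
     w i = w (rev_ord i) -> i = rev_ord i \/ (2 < mult gr (w i))%N) ->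
  (* (G5) *)
  (forall i j : 'I_n, is_weight gr (w i + w j) ->
     is_weight gr (w (rev_ord i) + w (rev_ord j)) ->
     w j = w (rev_ord i) /\ w i = w (rev_ord j)) ->
  exists (e : 'I_n -> 'rV[R]_n) (G : 'M[R]_n),
    [/\ (\matrix_(i < n) e i) \in unitmx,
        forall i, (e i <= gr (w i))%MS,
        is_metric G,
        forall i j : 'I_n, bform G (e i) (e j) = (j == rev_ord i)%:R
      & ricci_flat br G].
Proof.
move=> [brDl brDr brxx _] _ _ [[s [_ _ _ full]] grM] ws G1 G2 G3 G4 G5.
have [E0 [uE0 E0w coordw]] := adapted_basis ws full.
have weight k : is_weight gr (w k).
  by rewrite /is_weight -[\rank _]/(mult gr _) -ws card_gt0; apply/set0Pn; exists k; rewrite inE.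
(* (G5) turns both sums into [w k + w (rev_ord k)], which (G2) allows to be a weight only at the
   last index. *)
have hats k l i j : w k + w l = w i -> w (rev_ord k) + w (rev_ord l) = w j ->
    [/\ w l = w (rev_ord k), w k = w (rev_ord l),
        (i : nat) = n.-1 & (j : nat) = n.-1].
  move=> ei ej; have [||e1 e2] := G5 k l; rewrite ?ei ?ej //; split=> //.
    by apply: (G2 k); rewrite -e1.
  by apply: (G2 k); rewrite e2 addrC.
pose br0 := transport br E0.
have br0Dl := transportDl E0 brDl; have br0Dr := transportDr E0 brDr.
have hom0 k : homogeneous_mx w (w k) (structure_mx br0 k).
  move=> i j; rewrite mxE /br0 /transport -!rowE => nz; apply/esym; apply: coordw nz.
  exact: grM.
have sk0 k : skew_mx (structure_mx br0 k).
  have br0xx x : br0 x x = 0 by rewrite /br0 /transport brxx mul0mx.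
  by move=> i j; rewrite mxE [in RHS]mxE /br0 (bracket_skew br0Dl br0Dr br0xx) [LHS]mxE.
have others a (S : {set 'I_n}) : (#|S| < mult gr a)%N -> exists2 k, k \notin S & w k = a.
  rewrite -ws ltnNge => /negP nle.
  have /subsetPn[k] : ~~ ([set i | w i == a] \subset S).
    by apply/negP => /subset_leq_card.
  by rewrite inE => /eqP; exists k.
have brPE P Q (PQ : P *m Q = 1%:M) x y :
    transport br (P *m E0) x y = br0 (x *m P) (y *m P) *m Q.
  have uP : P \in unitmx by case: (mulmx1_unit PQ).
  apply: (canLR (mulmxK _)); first by rewrite unitmx_mul uP.
  by rewrite !mulmxA (transportE br uE0) -(mulmxA _ Q) (mulmx1C PQ) mulmx1.
have brPc P Q (PQ : P *m Q = 1%:M) i j k :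
    transport br (P *m E0) (delta_mx 0 i) (delta_mx 0 j) 0 k =
    \sum_l (P *m structure_mx br0 l *m P^T) i j * Q l k.
  rewrite (brPE _ _ PQ) mxE; apply: eq_bigr => l _.
  by rewrite -!rowE bracket_coord_rows.
have homP P Q (PQ : P *m Q = 1%:M) : graded_mx w P -> graded_mx w Q ->
    forall i j k, transport br (P *m E0) (delta_mx 0 i) (delta_mx 0 j) 0 k != 0 ->
    w i + w j = w k.
  move=> gP gQ i j k; rewrite (brPE _ _ PQ) -!rowE => /mulmx_neq0[l nz /gQ <-].
  by move: nz; rewrite bracket_coord_rows //; apply: homogeneous_congr.
have [P [Q [PQ gP gQ]] null] : exists2 P, graded_unit w P &
    forall m : 'I_n, (m : nat) = n.-1 -> \sum_k \sum_l
      transport br (P *m E0) (delta_mx 0 k) (delta_mx 0 l) 0 m *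
      transport br (P *m E0) (delta_mx 0 (rev_ord k)) (delta_mx 0 (rev_ord l)) 0 m = 0.
  have [[i0 m] /= /andP[/eqP mn /eqP wm]|none] := pickP (fun x : 'I_n * 'I_n =>
      (x.2 == n.-1 :> nat) && (w x.1 + w (rev_ord x.1) == w x.2)).
    (* By (G2) the last weight has multiplicity one here. Hence column [m] of [Q] is zero off the
       diagonal, and the last coordinate of the new bracket is [Q m m] times the congruent form. *)
    have uniq_m l : w l = w m -> l = m.
      by move=> wl; apply: val_inj; rewrite /= mn (G2 i0 l) // wm.
    have pairs : spare_index w (w m).
      move=> i nri wi.
      have [eqw|neqw] := eqVneq (w i) (w (rev_ord i)).
        have [/eqP|lt] := G4 i m mn wi eqw; first by rewrite (negPf nri).
        have [|k] := others (w i) [set i; rev_ord i]; first by rewrite cards2 nri.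
        by rewrite !inE negb_or => /andP[? ?] ?; exists k; split=> //; left.
      have [] := G3 i m mn wi neqw => lt.
        have [|k] := others (w i) [set i]; first by rewrite cards1.
        rewrite inE => ki wk; exists k; split=> //; last by left.
        by apply: contra_neq neqw => <-.
      have [|k] := others (w (rev_ord i)) [set rev_ord i]; first by rewrite cards1.
      rewrite inE => ki wk; exists k; split=> //; last by right.
      by apply: contra_neq neqw => e; rewrite -wk e.
    have [|P [Q [PQ gP gQ]] z] := @zero_hat_norm R n A w (w m) _ _ (sk0 m) (hom0 m) pairs.
      by move=> i j e1 e2; have [] := hats i j m m e1 e2.
    exists P; first by exists Q.
    move=> m' m'n; have {m' m'n}-> : m' = m by apply: val_inj; rewrite /= m'n mn.
    have cE i j : transport br (P *m E0) (delta_mx 0 i) (delta_mx 0 j) 0 m =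
        (P *m structure_mx br0 m *m P^T) i j * Q m m.
      rewrite (brPc _ _ PQ) (bigD1 m) //= big1 ?addr0 // => l nlm.
      suff -> : Q l m = 0 by rewrite mulr0.
      by apply/eqP; apply: contraNT nlm => /gQ/uniq_m->.
    under eq_bigr => k _ do under eq_bigr => l _ do rewrite !cE mulrACA.
    under eq_bigr => k _ do rewrite -mulr_suml.
    by rewrite -mulr_suml -/(hat_norm _) z mul0r.
  (* No pair [i], [rev_ord i] reaches the last weight. By [hats] a nonzero product would produce
     such a pair, so the initial basis already works. *)
  exists 1%:M; first exact: graded_unit1.
  move=> m mn; rewrite big1 // => k _; rewrite big1 // => l _.
  apply/eqP; have /= := none (k, m); apply: contraFT.
  have hom1 := homP _ _ (mulmx1 _) (graded_mx1 w) (graded_mx1 w).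
  rewrite mn eqxx mulf_eq0 negb_or => /andP[/hom1 e1 /hom1 e2].
  by have [<- _ _ _] := hats _ _ _ _ e1 e2; rewrite e1 eqxx.
have uE : P *m E0 \in unitmx by rewrite unitmx_mul uE0; case: (mulmx1_unit PQ) => ->.
set E := P *m E0 in null uE *.
have homE := homP _ _ PQ gP gQ.
(* The metric whose Gram matrix in the rows of [E] is antidiagonal. *)
exists (fun i => row i E), (invmx E *m hat_mx R n *m (invmx E)^T); split.
- by rewrite (_ : \matrix_i _ = E) //; apply/row_matrixP=> i; rewrite rowK.
- move=> i; rewrite row_mul mulmx_sum_row summx_sub // => k _.
  rewrite mxE; have [->|/gP->] := eqVneq (P i k) 0; first by rewrite scale0r sub0mx.
  exact: scalemx_sub.
- split; last exact: transport_metric_unit (hat_mx_unit R n).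
  by rewrite !trmx_mul trmxK hat_mx_sym mulmxA.
- move=> i j; rewrite !rowE bform_transport // bform_hatr mxE eqxx /=.
  by rewrite -(inj_eq rev_ord_inj) rev_ordK.
apply: ricci_flat_transport => //; first exact: hat_mx_unit.
have brE_Dl := transportDl E brDl; have brE_Dr := transportDr E brDr.
apply: ricci_flat_basis => // i j.
rewrite ricci_hatE //.
- suff -> : \sum_k \sum_l
      transport br E (delta_mx 0 k) (delta_mx 0 l) 0 (rev_ord j) *
      transport br E (delta_mx 0 (rev_ord k)) (delta_mx 0 (rev_ord l)) 0 (rev_ord i) = 0.
    by rewrite mul0r.
  (* Either both output coordinates are the last one, where [P] was chosen to make the sum zero, or
     [hats] kills each term. *)
  have [/andP[/eqP jn /eqP iN]|nlast] := boolP ((rev_ord j == n.-1 :> nat) && (rev_ord i == n.-1 :> nat)).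
    have -> : rev_ord i = rev_ord j by apply: val_inj; rewrite /= in jn iN *; rewrite jn iN.
    exact: null.
  rewrite big1 // => k _; rewrite big1 // => l _.
  apply/eqP; apply: contraNT nlast; rewrite mulf_eq0 negb_or => /andP[/homE e1 /homE e2].
  by have [_ _ -> ->] := hats _ _ _ _ e1 e2; rewrite eqxx.
- by move=> x; rewrite /transport brxx mul0mx.
- by move=> a b k ab /homE e; apply: G1.
Qed.
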